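(* Assume (C1q), (C2q), (C4q) hold (with rates $\sigma_1,\sigma_2,\sigma_4$). Put $Q:=\max\{\sigma_1(b_A-1)-1,0\}$ and let $K\in\mathbb{N}^*$ be such that $$K\ge\max\left\{\|x_Q-p\|,\frac{\|u-Ap\|}{\gamma}\right\}.$$ Suppose $\tau:\mathbb{N}\to\mathbb{N}$ is a monotone function satisfying, for all $k,m\in\mathbb{N}$ and all $x\in\overline{B}_K(p)$: $$\|x-\tilde T_m x\|\le\frac{1}{\tau(k)+1}\quad\text{implies}\quad\forall i<l\ \left(\|x-T_ix\|<\frac{1}{k+1}\right).$$ Then, for every $k\in\mathbb{N}$ and $f:\mathbb{N}\to\mathbb{N}$, $$\exists N\le\Omega(k,f)\ \forall i,j\in[N,\tilde f(N)]\ \left(\|x_i-x_j\|\le\frac{1}{k+1}\right),$$ where $\Omega(k,f)=\sigma\bigl(k_0,\tilde\phi(24K(h_{k,f}^{(E)}(0)+1)^2)\bigr)+Q$, with $$\sigma(k,n)=\sigma_2\left(\left\lceil\frac{n+\lceil\ln(12K^2(k+1))\rceil}{\gamma}\right\rceil+Q+1\right)-Q,\qquad k_0=4(k+1)^2-1,$$ $$\tilde\phi(k)=\tilde\Phi(\tau(k)),\qquad \tilde\Phi(k)=\max\{\hat\Sigma((l+1)(k+1)-1),\Psi((l+1)(k+1)-1)\},$$ $$\hat\Sigma(k)=\sigma_2\left(N_4(k)+l+1+\left\lceil\frac{\ln(4K(k+1))}{\gamma}\right\rceil\right),\qquad N_4(k)=\sigma_4(2(b_A+1)K(k+1)-1),$$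 $$\Psi(k)=\max\{\sigma_1((b_A+1)K(k+1)-1)-1,0\},$$ $$E=2^83^3b_AK^2\left(\left\lceil\tfrac12 b_A\tilde K^2\right\rceil+2b_U\tilde K\right)\left\lceil\frac1\gamma\right\rceil^2(k+1)^4,\qquad \tilde K=K+b_p,$$ $$h_{k,f}(m)=\max\{\eta(k_0,\tilde\phi(K_m),\tilde f),\ \tilde f(\sigma(k_0,\tilde\phi(K_m))),\ K_m\}+1,\qquad K_m=24K(m+1)^2,$$ $$\eta(k,n,f)=\max\{24K(k+1)(f(\sigma(k,n))+1),\ f(\sigma(k,n)),\ 6k+5\},\qquad \tilde f(n)=\max_{k\le n}f(k).$$ (In $\Omega(k,f)$, $k_0$ and $E$ are computed from the given $k$.)
   Context: $\mathbb{N}=\{0,1,2,\dots\}$, $\mathbb{N}^*=\mathbb{N}\setminus\{0\}$. $[a,b]$ with $a,b\in\mathbb{N}$ denotes the set of integers $j$ with $a\le j\le b$; $g^{(j)}$ is the $j$-th iterate of $g:\mathbb{N}\to\mathbb{N}$ ($g^{(0)}=\mathrm{id}$); monotone functions on $\mathbb{N}$ are nondecreasing; subtractions are in $\mathbb{Z}$. $\overline{B}_K(p)$ is the closed ball of radius $K$ centred at $p$. Setting: $H$ is a real Hilbert space; $A$ is a self-adjoint bounded linear operator on $H$ with $\langle Ax,x\rangle\ge\gamma\|x\|^2$ for all $x\in H$, where $0<\gamma\le1$. $l\in\mathbb{N}$, $l\ge1$, and $T_0,\dots,T_{l-1}:H\to H$ are nonexpansive with $F:=\bigcap_{i=0}^{l-1}\mathrm{Fix}(T_i)\ne\emptyset$;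 for $n\ge l$, $T_n:=T_{n\bmod l}$; $\tilde T_i:=T_{i+l}\cdots T_{i+1}$ (composition) for $i\in\mathbb{N}$. $u\in H$, $(\alpha_n)_{n\in\mathbb{N}}\subset(0,1]$, and $(x_n)$ is Xu's iteration: $x_0\in H$, $x_{n+1}=(I-\alpha_{n+1}A)T_{n+1}x_n+\alpha_{n+1}u$. Take $p\in F$ and $b_A,b_U,b_p\in\mathbb{N}^*$ with $b_A\ge\|A\|$, $b_U\ge\|u\|$, $b_p\ge\|p\|$. Quantitative conditions (the rates $\sigma_i:\mathbb{N}\to\mathbb{N}$ are assumed increasing, i.e. monotone): (C1q) $\forall k\,\forall n\ge\sigma_1(k)$: $\alpha_n\le\frac1{k+1}$. (C2q) $\forall k$: $\sum_{n=0}^{\sigma_2(k)}\alpha_n\ge k$. (C4q) $\sigma_4$ is a Cauchy modulus of the partial sums $S_n=\sum_{i=0}^{n}|\alpha_i-\alpha_{i+l}|$: $\forall k\,\forall n,m\ge\sigma_4(k)$: $|S_n-S_m|\le\frac1{k+1}$. *)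

(* Defs.v *)
From HB Require Import structures.
From mathcomp Require Import all_boot all_order all_algebra.
From mathcomp Require Import all_classical all_reals all_analysis.
From mathcomp Require Import sesquilinear.
Set Implicit Arguments.
Unset Strict Implicit.
Unset Printing Implicit Defensive.
Import Order.TTheory GRing.Theory Num.Theory.
Import numFieldNormedType.Exports.
Local Open Scope classical_set_scope.
Local Open Scope ring_scope.

Definition opnorm (R : realType) (H : normedModType R) (A : H -> H) : R :=
  sup [set `|A x| | x in closed_ball_ Num.norm 0 1].

Definition self_adjoint (R : realType) (H : lmodType R) (ip : H -> H -> R)
    (A : H -> H) : Prop :=
  forall x y, ip (A x) y = ip x (A y).

Definition nonexpansive (R : realType) (H : normedModType R) (S : H -> H) :
    Prop :=
  forall x y, `|S x - S y| <= `|x - y|.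

Definition Fix (X : Type) (S : X -> X) : set X := [set x | S x = x].

(* T_n := T_(n mod l); only the values T 0, ..., T (l - 1) of T are used. *)
Definition Tcyc (X : Type) (l : nat) (T : nat -> X -> X) (n : nat) : X -> X :=
  T (n %% l)%N.

(* T_(m+l) o ... o T_(m+1): T_(m+1) is applied first. *)
Definition Ttilde (X : Type) (l : nat) (T : nat -> X -> X) (m : nat) (x : X)
    : X :=
  iteri l (fun j => Tcyc l T (m + j + 1)) x.

(* Only applied to nonnegative x, where it is the usual ceiling. *)
Definition ceiln (R : realType) (x : R) : nat := `|Num.ceil x|%N.

Definition ftilde (f : nat -> nat) (n : nat) : nat := \max_(k < n.+1) f k.

(* Subtractions are truncated subtractions on nat.  This renders             *)
(* max{_ - 1, 0} in Q and Psi; elsewhere no truncation occurs when            *)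
(* bA, K >= 1.  In sigma this holds when sigma2 is a rate of divergence of a  *)
(* series with terms in (0, 1]: the sum of the first sigma2 m + 1 terms is at *)
(* least m, so sigma2 m >= m - 1 >= Q for every m >= Q + 1.                   *)
Section Rates.
Variables (R : realType) (gamma : R) (l K bA bU bp : nat).
Variables (sigma1 sigma2 sigma4 tau : nat -> nat).

Local Open Scope nat_scope.

Definition Q : nat := sigma1 (bA - 1) - 1.

Definition sigma (k n : nat) : nat :=
  sigma2 (ceiln ((n + ceiln (ln ((12 * K ^ 2 * (k + 1))%:R : R)))%:R / gamma)%R
          + Q + 1) - Q.

Definition N4 (k : nat) : nat := sigma4 (2 * (bA + 1) * K * (k + 1) - 1).

Definition Sigmahat (k : nat) : nat :=
  sigma2 (N4 k + l + 1 + ceiln (ln ((4 * K * (k + 1))%:R : R) / gamma)%R).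

Definition Psi (k : nat) : nat := sigma1 ((bA + 1) * K * (k + 1) - 1) - 1.

Definition Phitilde (k : nat) : nat :=
  maxn (Sigmahat ((l + 1) * (k + 1) - 1)) (Psi ((l + 1) * (k + 1) - 1)).

Definition phitilde (k : nat) : nat := Phitilde (tau k).

Definition Ktilde : nat := K + bp.

Definition E (k : nat) : nat :=
  2 ^ 8 * 3 ^ 3 * bA * K ^ 2
  * (ceiln (2^-1 * (bA * Ktilde ^ 2)%:R : R)%R + 2 * bU * Ktilde)
  * ceiln (1 / gamma)%R ^ 2 * (k + 1) ^ 4.

Definition eta (k n : nat) (f : nat -> nat) : nat :=
  maxn (24 * K * (k + 1) * (f (sigma k n) + 1))
       (maxn (f (sigma k n)) (6 * k + 5)).

Definition k0 (k : nat) : nat := 4 * (k + 1) ^ 2 - 1.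

Definition Km (m : nat) : nat := 24 * K * (m + 1) ^ 2.

Definition h (k : nat) (f : nat -> nat) (m : nat) : nat :=
  maxn (eta (k0 k) (phitilde (Km m)) (ftilde f))
       (maxn (ftilde f (sigma (k0 k) (phitilde (Km m)))) (Km m)) + 1.

Definition Omega (k : nat) (f : nat -> nat) : nat :=
  sigma (k0 k) (phitilde (24 * K * (iter (E k) (h k f) 0 + 1) ^ 2)) + Q.

End Rates.

(* Main.v *)
(* Write J y = <A y, y> / 2 - <u, y>, whose minimizer over F is the limit of  *)
(* the iteration.  Along the almost fixed points of precision                 *)
(* 1 / (h^(i)(0) + 1), i <= E, the infimum of J increases by at most the      *)
(* range of J, so for some i < E there is a q of precision                    *)
(* 1 / (h^(i+1)(0) + 1) almost minimizing J at precision 1 / (m + 1), where   *)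
(* m = h^(i)(0).  Segments between almost fixed points are almost fixed, so   *)
(* that q almost satisfies the variational inequality                         *)
(* <u - A q, y - q> <= 0 at every almost fixed y in the ball.  As x_n is      *)
(* almost fixed from some index n1 on, Xu's recursive inequality for          *)
(* |x_n - q|^2 brings x_n close to q.                                         *)
(* The index N_4 may lie below Q, in which case asymptotic regularity at the  *)
(* claimed rate can fail.  But (C4q) and alpha -> 0 force alpha to be small   *)
(* after N_4, so the sum of the alpha_n needed to reach asymptotic regularity *)
(* is still covered by the summand n of sigma (k, n).                         *)

(* Metastability asks for closeness only on the interval from N to [ftilde f N], so the minimizer of
   J over F may be replaced by a point q whose precision depends on f. Such a q comes from a
   counting argument ([exists_almost_min]): J varies by at most [E] times the tolerance, so a
   descent through the levels h^(i)(0) must stop at some i < [E] ([exists_energy_almost_min]).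

   By [segment_almost_fixed], the points of a segment between almost fixed points are still almost
   fixed, so q competes with them. The quadratic expansion of J along the segment then gives the
   approximate variational inequality ([variational_le], [variational_almost_min]).

   The iterates become almost fixed because x_(n+l) - x_n contracts up to the variation of [alpha],
   while x_(n+l) stays near the cyclic composition at x_n ([x_asymptotically_regular]). The index n1
   from which this holds is controlled only through the sum of [alpha] up to n1 ([exists_block],
   [x_almost_fixed]). This suffices, as [sigma] is a waiting time measured in such sums.

   Finally [x_sub_sq_le] bounds |x_s - q|^2 by a damped initial error, the variational error and the
   accumulated error of q as an almost fixed point. These get the shares 1/12, 5/72 and 7/72 of
   1/(k+1)^2, which add up to the square of 1/(2(k+1)). *)
Require Import Defs.
From HB Require Import structures.
From mathcomp Require Import all_boot all_order all_algebra.
From mathcomp Require Import all_classical all_reals all_analysis.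
From mathcomp Require Import sesquilinear.
From mathcomp Require Import zify ring lra.
Set Implicit Arguments.
Unset Strict Implicit.
Unset Printing Implicit Defensive.
Import Order.TTheory GRing.Theory Num.Theory.
Import numFieldNormedType.Exports.
Local Open Scope classical_set_scope.
Local Open Scope ring_scope.

(** * Recursive inequalities and sums of step sizes *)

Section RealSequences.
Variable R : realType.
Implicit Types (s a c : nat -> R) (g b e : R).

(** As 1 - t <= exp(-t), the initial value decays exponentially in the sum of the steps. The level b
    is reproduced by the convex combination, and the errors c are merely added up. *)
Lemma recursion_bound s a c g b M :
  0 <= b -> 0 <= s M ->
  (forall n, (M <= n)%N -> 0 <= c n) ->
  (forall n, (M <= n)%N -> 0 <= g * a n <= 1) ->
  (forall n, (M <= n)%N ->
     s n.+1 <= (1 - g * a n) * s n + g * a n * b + c n) ->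
  forall n, (M <= n)%N ->
    s n <= expR (- (g * \sum_(M <= j < n) a j)) * s M + b
           + \sum_(M <= j < n) c j.
Proof.
move=> b0 sM0 c0 ga s_rec n; elim: n => [|n IHn].
  rewrite leqn0 => /eqP M0; subst M.
  by rewrite !big_geq// mulr0 oppr0 expR0 mul1r addr0; lra.
rewrite leq_eqVlt ltnS => /orP[/eqP ME|Mn].
  by rewrite ME !big_geq// mulr0 oppr0 expR0 mul1r addr0; lra.
have {}IHn := IHn Mn.
rewrite !big_nat_recr//= mulrDr opprD expRD.
set S := \sum_(M <= i < n) a i in IHn *.
set C := \sum_(M <= i < n) c i in IHn *.
have /andP[ga0 ga1] := ga n Mn.
have C0 : 0 <= C.
  by rewrite /C big_nat_cond sumr_ge0// => i /andP[/andP[? _] _]; exact: c0.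
have e0 := expR_ge0 (- (g * S)).
have e1 : 1 - g * a n <= expR (- (g * a n)) by apply: expR_ge1Dx.
apply: (le_trans (s_rec n Mn)).
have h1 : (1 - g * a n) * s n <=
    (1 - g * a n) * (expR (- (g * S)) * s M + b + C).
  by apply: ler_wpM2l => //; lra.
have h2 : (1 - g * a n) * (expR (- (g * S)) * s M) <=
    expR (- (g * a n)) * (expR (- (g * S)) * s M).
  by apply: ler_wpM2r => //; exact: mulr_ge0.
have h3 : 0 <= g * a n * C by exact: mulr_ge0.
nra.
Qed.

(* [a i - a (i + l)] is summed along the progression n, n + l, n + 2l, ...,   *)
(* which only visits part of the tail of the total variation.                 *)
Lemma le_tail_variation a l N e :
  (0 < l)%N ->
  (forall d : R, 0 < d -> exists n0, forall n, (n0 <= n)%N -> a n <= d) ->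
  (forall n m, (N < n <= m)%N -> \sum_(n <= i < m) `|a i - a (i + l)%N| <= e) ->
  forall n, (N < n)%N -> a n <= e.
Proof.
move=> l0 a0 Ve n Nn.
have step j : a n <= a (n + j * l)%N
    + \sum_(n <= i < n + j * l) `|a i - a (i + l)%N|.
  elim: j => [|j IHj]; first by rewrite mul0n addn0 big_geq// addr0.
  apply: (le_trans IHj).
  have -> : (n + j.+1 * l = n + j * l + l)%N by lia.
  rewrite (@big_cat_nat _ _ _ (n + j * l) n (n + j * l + l)%N)/=; [|lia|lia].
  rewrite [X in _ <= _ + (_ + X)]big_ltn; last by lia.
  have := ler_norm (a (n + j * l)%N - a (n + j * l + l)%N).
  have : 0 <= \sum_((n + j * l).+1 <= i < n + j * l + l) `|a i - a (i + l)%N|.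
    exact: sumr_ge0.
  lra.
apply/ler_addgt0Pr => d d0.
have [n0 Hn0] := a0 _ d0.
have ad : a (n + n0 * l)%N <= d.
  by apply: Hn0; apply: (leq_trans (leq_pmulr n0 l0)); rewrite leq_addl.
have := step n0; have := Ve n (n + n0 * l)%N; rewrite Nn leq_addr => /(_ isT).
lra.
Qed.

Lemma sum_le_const a e m n : (m <= n)%N ->
  (forall i, (m <= i)%N -> a i <= e) ->
  \sum_(m <= i < n) a i <= (n - m)%:R * e.
Proof.
move=> mn ae; rewrite mulr_natl -sumr_const_nat.
by rewrite big_nat_cond [leRHS]big_nat_cond ler_sum// => i /andP[/andP[? _] _]; exact: ae.
Qed.

(* M may exceed N: after N the terms are at most e, so that the sum up to     *)
(* M + l is small compared to M even though it is not bounded in terms of N.  *)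
Lemma exists_block a e (l N M L n : nat) :
  (0 < l)%N -> (0 < L)%N -> 0 <= e <= 2^-1 ->
  (forall i, 0 <= a i <= 1) ->
  (forall i, (N < i)%N -> a i <= e) ->
  (N <= M)%N -> (M <= n)%N ->
  (N + l + 1 + L)%:R <= \sum_(0 <= i < n.+1) a i ->
  (forall k : nat, exists m, k%:R <= \sum_(0 <= i < m) a i) ->
  exists n1, [/\ (M <= n1)%N,
    L%:R <= \sum_(M <= j < n1) a (j + l + 1)%N &
    \sum_(0 <= i < n1.+1) a i <= (n + 1)%:R].
Proof.
move=> l0 L0 /andP[e0 e12] a01 ae NM Mn n_sum a_div.
have sum_mono i j : (i <= j)%N ->
    \sum_(0 <= t < i) a t <= \sum_(0 <= t < j) a t.
  move=> ij; rewrite (@big_cat_nat _ _ _ i 0 j)//= lerDl.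
  by apply: sumr_ge0 => t _; have /andP[] := a01 t.
have block m : (M <= m)%N -> \sum_(M <= j < m) a (j + l + 1)%N
    = \sum_(0 <= i < m + l + 1) a i - \sum_(0 <= i < M + l + 1) a i.
  move=> Mm; rewrite [X in X - _](@big_cat_nat _ _ _ (M + l + 1))//=; [|lia].
  rewrite [LHS](_ : _ = \sum_(M <= j < m) a (j + (l + 1))%N); last first.
    by apply: eq_bigr => j _; rewrite addnA.
  have -> : \sum_(M + l + 1 <= i < m + l + 1) a i
      = \sum_(M + (l + 1) <= i < m + (l + 1)) a i by rewrite !addnA.
  rewrite (big_addn M (m + (l + 1))) addnK.
  by rewrite addrAC subrr add0r.
have exn : exists m, (M <= m)%N && (L%:R <= \sum_(M <= j < m) a (j + l + 1)%N).
  have [m Hm] := a_div (M + l + 1 + L)%N.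
  exists (maxn M m); rewrite leq_maxl/= block ?leq_maxl//.
  have h1 : \sum_(0 <= i < m) a i <= \sum_(0 <= i < maxn M m + l + 1) a i.
    by apply: sum_mono; lia.
  have h2 : \sum_(0 <= i < M + l + 1) a i <= (M + l + 1 - 0)%:R * 1.
    by apply: sum_le_const => // i _; have /andP[] := a01 i.
  rewrite subn0 mulr1 in h2; rewrite natrD in Hm; lra.
case: (ex_minnP exn) => n1 /andP[Mn1 Ln1] n1_min.
exists n1; split => //.
have Mltn1 : (M < n1)%N.
  rewrite ltn_neqAle Mn1 andbT; apply/eqP => ME.
  by move: Ln1; rewrite ME big_geq// lern0; lia.
have Ln1' : \sum_(M <= j < n1.-1) a (j + l + 1)%N < L%:R.
  rewrite ltNge; apply/negP => Lc.
  have := n1_min n1.-1; rewrite Lc andbT => /(_ ltac:(lia)); lia.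
rewrite block in Ln1'; last lia.
have sumN m : (N < m)%N -> \sum_(0 <= i < m) a i <= (N + 1)%:R + (m - (N + 1))%:R * e.
  move=> Nm; rewrite (@big_cat_nat _ _ _ (N + 1) 0 m)//=; last lia.
  apply: lerD.
    have := @sum_le_const a 1 0 (N + 1) isT; rewrite subn0 mulr1; apply => i _.
    by have /andP[] := a01 i.
  by apply: sum_le_const => [|i Ni]; [lia | apply: ae; lia].
(* As the terms after N are at most 1/2, [n_sum] forces L + l <= (n - N)/2, and the sum up to M + l
   is at most N + 1 + (M - N + l)/2. With M <= n and 1 <= l, these bounds and one more term of size
   at most 1/2 add up to at most n + 1. *)
have hn := sumN n.+1 ltac:(lia).
have hM := sumN (M + l + 1)%N ltac:(lia).
have hn1 : \sum_(0 <= i < n1.+1) a i <= \sum_(0 <= i < n1.-1 + l + 1) a i + e.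
  have : \sum_(0 <= i < n1.+1) a i <= \sum_(0 <= i < (n1.-1 + l + 1).+1) a i.
    by apply: sum_mono; lia.
  rewrite [X in _ <= X]big_nat_recr//=.
  have := ae (n1.-1 + l + 1)%N ltac:(lia); lra.
rewrite natrB in hn; last lia.
rewrite natrB in hM; last lia.
have l1 : 1 <= l%:R :> R by rewrite ler1n.
have MnR : M%:R <= n%:R :> R by rewrite ler_nat.
have NMR : N%:R <= M%:R :> R by rewrite ler_nat.
have half (t : R) : 0 <= t -> t * e <= t / 2 by move=> t0; exact: ler_wpM2l.
have := half (n%:R - N%:R) ltac:(lra).
have := half (M%:R - N%:R) ltac:(lra).
have := half l%:R ltac:(lra).
clear -hn hM n_sum hn1 Ln1' l1 e12 MnR.
move: hn hM n_sum hn1 Ln1'.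
set s1 := \sum_(_ <= i < n.+1) _; set s2 := \sum_(_ <= i < M + l + 1) _.
set s3 := \sum_(_ <= i < n1.+1) _; set s4 := \sum_(_ <= i < n1.-1 + l + 1) _.
rewrite -?(addn1 n) !natrD; lra.
Qed.

End RealSequences.

(** * Hilbert space geometry and the quadratic functional J *)

Section InnerProduct.
Variables (R : realType) (H : normedModType R) (ip : {dot H for idfun}).
Hypothesis ip_norm : forall x : H, `|x| = Num.sqrt (ip x x).
Implicit Types (x y z q u v : H) (A S : H -> H).

Lemma ipC x y : ip x y = ip y x.
Proof. by rewrite hermC expr0 mul1r. Qed.

Lemma ipE x : ip x x = `|x| ^+ 2.
Proof.
rewrite ip_norm sqr_sqrtr//; have [->|/neq0_dnorm_gt0 /ltW//] := eqVneq x 0.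
by rewrite linear0l.
Qed.

Lemma ipDl x y z : ip (x + y) z = ip x z + ip y z.
Proof. exact: linearDl. Qed.

Lemma ipNl x z : ip (- x) z = - ip x z.
Proof. exact: linearNl. Qed.

Lemma ipZl (t : R) x z : ip (t *: x) z = t * ip x z.
Proof. exact: linearZl_LR. Qed.

Lemma ipDr x y z : ip x (y + z) = ip x y + ip x z.
Proof. exact: linearDr. Qed.

Lemma ipNr x z : ip x (- z) = - ip x z.
Proof. exact: linearNr. Qed.

Lemma ipZr (t : R) x z : ip x (t *: z) = t * ip x z.
Proof. by rewrite ipC ipZl ipC. Qed.

Definition ip_bilinear := (ipDl, ipNl, ipZl, ipDr, ipNr, ipZr).

Lemma ip_le x y : ip x y <= `|x| * `|y|.
Proof.
have [->|x0] := eqVneq x 0; first by rewrite linear0l normr0 mul0r.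
have [->|y0] := eqVneq y 0; first by rewrite linear0r normr0 mulr0.
have : 0 < `|x| * `|y| by rewrite mulr_gt0 ?normr_gt0.
have : 0 <= ip (`|y| *: x - `|x| *: y) (`|y| *: x - `|x| *: y).
  by rewrite ipE sqr_ge0.
rewrite !ip_bilinear (ipC y x) !ipE => h0 h1.
suff : 0 <= (`|x| * `|y|) * (`|x| * `|y| - ip x y).
  by rewrite pmulr_rge0// subr_ge0.
nra.
Qed.

Lemma normrD_sq x y : `|x + y| ^+ 2 = `|x| ^+ 2 + 2 * ip x y + `|y| ^+ 2.
Proof. rewrite -!ipE !ip_bilinear (ipC y x); ring. Qed.

Lemma normrD_sq_le x y : `|x + y| ^+ 2 <= `|x| ^+ 2 + 2 * ip y (x + y).
Proof.
rewrite normrD_sq ipDr ipE (ipC y x).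
by have := sqr_ge0 `|y|; lra.
Qed.

Lemma norm_convex_sq (t : R) x y :
  `|(1 - t) *: x + t *: y| ^+ 2
  = (1 - t) * `|x| ^+ 2 + t * `|y| ^+ 2 - t * (1 - t) * `|x - y| ^+ 2.
Proof. rewrite -!ipE !ip_bilinear (ipC y x); ring. Qed.

(** With D = |y - q|, nonexpansiveness puts S w within t D + e of q and within (1 - t) D + e of y.
    In [norm_convex_sq] the terms in D^2 cancel, leaving 4 t (1 - t) e D + e^2. The bound is on the
    square of the displacement, whence the square in [Km]. *)
Lemma segment_almost_fixed S (e d t : R) q y :
  nonexpansive S -> 0 <= t <= 1 -> 0 <= e -> `|y - q| <= d ->
  `|q - S q| <= e -> `|y - S y| <= e ->
  `|q + t *: (y - q) - S (q + t *: (y - q))| ^+ 2 <= e * d + e ^+ 2.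
Proof.
move=> S_ne /andP[t0 t1] e0 yqd qe ye; set w := q + _.
have near (v : H) : `|v - S v| <= e -> `|S w - v| <= `|w - v| + e.
  move=> ve; rewrite (_ : S w - v = (S w - S v) + (S v - v)); last first.
    by rewrite addrA subrK.
  by apply: (le_trans (ler_normD _ _)); rewrite lerD ?S_ne// distrC.
have wq : `|w - q| = t * `|y - q|.
  by rewrite /w addrAC subrr add0r normrZ ger0_norm.
have wy : `|w - y| = (1 - t) * `|y - q|.
  have -> : w - y = (t - 1) *: (y - q).
    rewrite /w scalerBl scale1r opprB addrA (addrC _ (t *: _)) -!addrA.
    by congr (_ + _); rewrite addrC.
  by rewrite normrZ -opprB normrN ger0_norm// subr_ge0.
have := near q qe; have := near y ye; rewrite wq wy.
have abE : w - S w = - ((1 - t) *: (S w - q) + t *: (S w - y)).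
  rewrite /w; set s := S _.
  have -> : (1 - t) *: (s - q) + t *: (s - y) = s - q + t *: (q - y).
    rewrite scalerBl scale1r -addrA; congr (_ + _).
    by rewrite addrC -scalerBr opprB addrC addrA subrK.
  by rewrite opprD opprB -scalerN opprB addrAC.
rewrite abE normrN norm_convex_sq.
have -> : S w - q - (S w - y) = y - q by rewrite opprB addrC addrA subrK.
have := normr_ge0 (y - q); set D := `|y - q| in yqd * => D0.
set na := `|S w - q|; set nb := `|S w - y| => nbD naD.
have na2 : na ^+ 2 <= (t * D + e) ^+ 2.
  have p0 : 0 <= t * D + e by apply: addr_ge0 => //; exact: mulr_ge0.
  by apply: lerXn2r => //; rewrite nnegrE normr_ge0.
have nb2 : nb ^+ 2 <= ((1 - t) * D + e) ^+ 2.
  have p0 : 0 <= (1 - t) * D + e.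
    by apply: addr_ge0 => //; apply: mulr_ge0; rewrite // subr_ge0.
  by apply: lerXn2r => //; rewrite nnegrE normr_ge0.
have h1 : (1 - t) * na ^+ 2 <= (1 - t) * (t * D + e) ^+ 2.
  by apply: ler_wpM2l => //; rewrite subr_ge0.
have h2 : t * nb ^+ 2 <= t * ((1 - t) * D + e) ^+ 2 by exact: ler_wpM2l.
have h3 : 4 * (t * (1 - t)) * (e * D) <= 1 * (e * D).
  apply: ler_wpM2r; first exact: mulr_ge0.
  by have := sqr_ge0 (2 * t - 1); nra.
have h4 : e * D <= e * d by exact: ler_wpM2l.
apply: (@le_trans _ _ (4 * (t * (1 - t)) * (e * D) + e ^+ 2)); last lra.
have -> : 4 * (t * (1 - t)) * (e * D) + e ^+ 2 = (1 - t) * (t * D + e) ^+ 2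
   + t * ((1 - t) * D + e) ^+ 2 - t * (1 - t) * D ^+ 2 by ring.
lra.
Qed.

Section Coercive.
Variables (A : {linear H -> H}) (g B : R).
Hypotheses (A_self_adjoint : self_adjoint ip A)
  (A_coercive : forall x, g * `|x| ^+ 2 <= ip (A x) x)
  (A_le : forall x, `|A x| <= B * `|x|).

Lemma ip_A_le x : ip (A x) x <= B * `|x| ^+ 2.
Proof.
apply: (le_trans (ip_le _ _)); rewrite expr2 mulrA.
exact: ler_wpM2r.
Qed.

(* With P = 1 - a A and c = 1 - a g, evaluate the positive form <P v, v> at    *)
(* v = x - s P x.                                                             *)
Lemma norm_id_sub_le (a : R) : 0 <= a -> a * g <= 1 -> a * B <= 1 ->
  forall x, `|x - a *: A x| <= (1 - a * g) * `|x|.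
Proof.
move=> a0 ag aB x.
set c := 1 - a * g; have c0 : 0 <= c by rewrite subr_ge0.
pose P (v : H) := v - a *: A v.
have P_sa v w : ip (P v) w = ip v (P w).
  by rewrite /P !ip_bilinear A_self_adjoint.
have P_ge0 v : 0 <= ip (P v) v.
  rewrite /P !ip_bilinear ipE subr_ge0.
  apply: (le_trans (ler_wpM2l a0 (ip_A_le v))).
  by rewrite mulrA -[leRHS]mul1r ler_wpM2r// sqr_ge0.
have P_le v : ip (P v) v <= c * `|v| ^+ 2.
  rewrite /P /c !ip_bilinear ipE mulrBl mul1r -mulrA.
  rewrite lerD2l lerN2; exact: ler_wpM2l.
have key (s : R) : 0 <= c * `|x| ^+ 2 - 2 * s * `|P x| ^+ 2 + s ^+ 2 * (c * `|P x| ^+ 2).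
  have := P_ge0 (x - s *: P x).
  have -> : P (x - s *: P x) = P x - s *: P (P x).
    have AE y : A (x - s *: y) = A x - s *: A y by rewrite linearB linearZ.
    rewrite {1 4}/P AE; rewrite !scalerBr !opprD !opprK !scalerA (mulrC a s).
    by rewrite addrACA.
  have := P_sa (P x) x; have := P_le (P x); have := P_le x.
  move: (P x) => y; move: (P y) => z h1 h2 zx.
  rewrite !ip_bilinear zx ipE => h.
  have h3 : s ^+ 2 * ip z y <= s ^+ 2 * (c * `|y| ^+ 2).
    by apply: ler_wpM2l => //; exact: sqr_ge0.
  lra.
rewrite -(@ler_pXn2r _ 2)// ?nnegrE ?mulr_ge0// -/(P x).
(* The optimal choice s = 1/c needs c nonzero; if c = 0, then s = 1 already forces P x = 0. *)
have [c_eq0|c_neq0] := eqVneq c 0.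
  by have := key 1; rewrite c_eq0 !mul0r expr0n/=; lra.
have ceiln_inv_gt0 : 0 < c by rewrite lt_neqAle eq_sym c_neq0.
have := key c^-1.
have -> : c * `|x| ^+ 2 - 2 / c * `|P x| ^+ 2 + c^-1 ^+ 2 * (c * `|P x| ^+ 2)
   = c^-1 * ((c * `|x|) ^+ 2 - `|P x| ^+ 2) by field.
by rewrite pmulr_rge0 ?invr_gt0// subr_ge0.
Qed.

(** For self-adjoint A the gradient at x is A x - u, which links minimization to the variational
    inequality. *)
Definition energy u x : R := 2^-1 * ip (A x) x - ip u x.

Lemma energy_segment u q x (t : R) :
  energy u (q + t *: (x - q)) = energy u q + t * ip (A q - u) (x - q)
    + 2^-1 * t ^+ 2 * ip (A (x - q)) (x - q).
Proof.
rewrite /energy; move: (x - q) => v.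
have -> : A (q + t *: v) = A q + t *: A v by rewrite linearD linearZ.
rewrite !ip_bilinear (A_self_adjoint v q) (ipC v (A q)); lra.
Qed.

(** Coercivity allows the quadratic term at y to be dropped. With c = [Ktilde], this range of J is
    the origin of the bracketed factor of [E]. *)
Lemma energy_diff_le u x y (c : R) : 0 <= B -> 0 <= g ->
  `|x| <= c -> `|y| <= c ->
  energy u x - energy u y <= 2^-1 * (B * c ^+ 2) + 2 * `|u| * c.
Proof.
move=> B0 g0 xc yc; rewrite /energy.
have hx := ip_A_le x; have hy := A_coercive y.
have hux : ip (- u) x <= `|u| * c.
  by apply: (le_trans (ip_le _ _)); rewrite normrN ler_wpM2l.
have huy : ip u y <= `|u| * c.
  by apply: (le_trans (ip_le _ _)); rewrite ler_wpM2l.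
rewrite ipNl in hux.
have x2 : B * `|x| ^+ 2 <= B * c ^+ 2.
  apply: ler_wpM2l => //; rewrite lerXn2r// nnegrE//.
  exact: le_trans (normr_ge0 x) xc.
have : 0 <= g * `|y| ^+ 2 by rewrite mulr_ge0// sqr_ge0.
lra.
Qed.

End Coercive.
End InnerProduct.

(** * The operator norm, and descent through finitely many levels *)

Lemma opnorm_ge (R : realType) (H : normedModType R) (A : {linear H -> H}) x :
  bounded_fun_norm A -> `|A x| <= opnorm A * `|x|.
Proof.
move=> A_bd; have [->|x0] := eqVneq x 0; first by rewrite linear0 !normr0 mulr0.
have nx : 0 < `|x| by rewrite normr_gt0.
rewrite -ler_pdivrMr//.
have -> : `|A x| / `|x| = `|A (`|x|^-1 *: x)|.
  by rewrite linearZ/= normrZ ger0_norm ?invr_ge0// mulrC.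
(* Boundedness of A ensures that the set has an upper bound, without which [sup] would only be a
   default value. *)
apply: ub_le_sup.
  have [M AM] := A_bd 1; exists M => _ [y + <-].
  by rewrite /closed_ball_/= sub0r normrN; exact: AM.
exists (`|x|^-1 *: x) => //; rewrite /closed_ball_/= sub0r normrN normrZ.
by rewrite ger0_norm ?invr_ge0// mulVf// gt_eqF.
Qed.

(* Descending the E levels from p, each failure costs more than d.            *)
Lemma exists_almost_min (R : realType) (X : Type) (J : X -> R)
    (C : nat -> X -> Prop) (p : X) (E : nat) (d : R) :
  (0 < E)%N -> (forall i, C i p) ->
  (forall y, C 0%N y -> J p - E%:R * d <= J y) ->
  exists i, [/\ (i < E)%N & exists2 q, C i.+1 q &
    forall y, C i y -> J q <= J y + d].
Proof.
move=> E0 Cp Jd; apply: contrapT => nex.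
have step i q : (i < E)%N -> C i.+1 q -> exists2 y, C i y & J y < J q - d.
  move=> iE Cq; apply: contrapT => ny; apply: nex; exists i; split => //.
  exists q => // y Cy; rewrite leNgt; apply/negP => Jyq.
  by apply: ny; exists y => //; lra.
have down j : (j < E)%N -> exists2 y, C (E - j)%N y & J y <= J p - j%:R * d.
  elim: j => [_|j IHj jE]; first by exists p => //; rewrite mul0r subr0.
  have [y Cy Jy] := IHj (ltnW jE).
  have [z Cz Jz] := step (E - j.+1)%N y ltac:(lia) ltac:(by rewrite subnSK// ltnW).
  by exists z => //; rewrite -addn1 natrD; lra.
have [y Cy Jy] := down E.-1 ltac:(lia).
have {}Cy : C 1%N y by rewrite (_ : 1 = E - E.-1)%N; [|lia].
(* This last failure, at level 0, brings the total cost strictly above E d, against [Jd]. *)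
have [z Cz Jz] := step 0%N y E0 Cy.
have := Jd z Cz; rewrite -{1}(prednK E0) -addn1 natrD; lra.
Qed.

(** * Estimates along Xu's iteration *)

Section XuIteration.
Variables (R : realType) (H : normedModType R) (A : {linear H -> H}).
Variables (g B K : R) (l Q0 : nat) (T : nat -> H -> H) (u p : H).
Variables (alpha : nat -> R) (x : nat -> H).
Hypotheses (g_gt0 : 0 < g) (g_le1 : g <= 1) (B_ge0 : 0 <= B) (K_gt0 : 0 < K).
Hypothesis A_le : forall v, `|A v| <= B * `|v|.
Hypotheses (l_gt0 : (0 < l)%N) (alpha01 : forall n, 0 < alpha n <= 1).
Hypothesis T_nonexpansive : forall i, (i < l)%N -> nonexpansive (T i).
Hypothesis T_p : forall i, (i < l)%N -> T i p = p.
Hypothesis x_rec : forall n, x n.+1 =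
  (Tcyc l T n.+1 (x n) - alpha n.+1 *: A (Tcyc l T n.+1 (x n)))
  + alpha n.+1 *: u.
Hypothesis contraction : forall n, (Q0 <= n)%N ->
  forall v, `|v - alpha n.+1 *: A v| <= (1 - g * alpha n.+1) * `|v|.
Hypotheses (xQ_le : `|x Q0 - p| <= K) (uAp_le : `|u - A p| <= g * K).

Lemma Tcyc_nonexpansive n : nonexpansive (Tcyc l T n).
Proof. by apply: T_nonexpansive; rewrite ltn_mod. Qed.

Lemma Tcyc_fix n : Tcyc l T n p = p.
Proof. by apply: T_p; rewrite ltn_mod. Qed.

Lemma g_alpha01 n : 0 <= g * alpha n <= 1.
Proof.
have /andP[a0 a1] := alpha01 n.
by rewrite mulr_ge0 ?(ltW g_gt0) ?(ltW a0)//= mulr_ile1 // ltW.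
Qed.

(** The reference point z is left free: it is p for boundedness, T_(n+1) x_n for increments, and the
    approximate minimizer q for convergence. *)
Lemma x_succ_sub n z (v := Tcyc l T n.+1 (x n) - z) :
  x n.+1 - z = (v - alpha n.+1 *: A v) + alpha n.+1 *: (u - A z).
Proof.
rewrite x_rec /v; set w := Tcyc _ _ _ _; set a := alpha n.+1.
have -> : A (w - z) = A w - A z by rewrite linearB.
rewrite !scalerBr opprB.
rewrite -[RHS]addrA.
have -> : a *: A z - a *: A w + (a *: u - a *: A z) = a *: u - a *: A w.
  by rewrite addrC addrA subrK.
by rewrite [RHS]addrA [LHS]addrAC [RHS]addrAC; congr (_ + _); rewrite addrAC.
Qed.

(** K dominates both the initial distance and |u - A p|/g, so each step is bounded by the convex
    combination (1 - g alpha) K + g alpha K. *)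
Lemma x_ball n : (Q0 <= n)%N -> `|x n - p| <= K.
Proof.
elim: n => [|n IHn]; first by rewrite leqn0 => /eqP <-.
rewrite leq_eqVlt => /orP[/eqP <-//|].
rewrite ltnS => Qn; rewrite x_succ_sub.
have /andP[a0 a1] := alpha01 n.+1; have /andP[ga0 ga1] := g_alpha01 n.+1.
apply: (le_trans (ler_normD _ _)).
rewrite normrZ (ger0_norm (ltW a0)).
have h1 : alpha n.+1 * `|u - A p| <= alpha n.+1 * (g * K).
  by apply: ler_wpM2l => //; exact: ltW.
have h2 := contraction Qn (Tcyc l T n.+1 (x n) - p).
have h3 : `|Tcyc l T n.+1 (x n) - p| <= K.
  rewrite -(Tcyc_fix n.+1).
  exact: (le_trans (Tcyc_nonexpansive _ _ _) (IHn Qn)).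
have h4 : (1 - g * alpha n.+1) * `|Tcyc l T n.+1 (x n) - p|
    <= (1 - g * alpha n.+1) * K by apply: ler_wpM2l => //; rewrite subr_ge0.
lra.
Qed.

Lemma residual_le n : (Q0 <= n)%N ->
  `|u - A (Tcyc l T n.+1 (x n))| <= (B + 1) * K.
Proof.
move=> Qn; set w := Tcyc _ _ _ _.
have -> : u - A w = (u - A p) + A (p - w) by rewrite linearB addrA subrK.
apply: (le_trans (ler_normD _ _)).
have h1 := A_le (p - w).
have h2 : `|p - w| <= K.
  rewrite distrC -(Tcyc_fix n.+1).
  exact: (le_trans (Tcyc_nonexpansive _ _ _) (x_ball Qn)).
have h3 : B * `|p - w| <= B * K by exact: ler_wpM2l.
have h4 : g * K <= 1 * K by rewrite ler_pM2r.
have := uAp_le; lra.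
Qed.

Lemma x_succ_dist n : (Q0 <= n)%N ->
  `|x n.+1 - Tcyc l T n.+1 (x n)| <= alpha n.+1 * ((B + 1) * K).
Proof.
move=> Qn; have /andP[a0 _] := alpha01 n.+1.
rewrite x_succ_sub subrr linear0 scaler0 subr0 add0r normrZ (ger0_norm (ltW a0)).
by rewrite ler_pM2l// residual_le.
Qed.

(** By periodicity both points arise from the same map T_(n+1). Comparing each with w = T_(n+1) x_n
    leaves one contracted difference and a multiple of u - A w whose coefficient is the variation of
    [alpha]. *)
Lemma shift_step n : (Q0 <= n)%N ->
  `|x (n.+1 + l)%N - x n.+1| <=
    (1 - g * alpha (n + l + 1)%N) * `|x (n + l)%N - x n|
    + `|alpha n.+1 - alpha (n.+1 + l)%N| * ((B + 1) * K).
Proof.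
move=> Qn; set w := Tcyc l T n.+1 (x n).
have Tw : Tcyc l T (n + l).+1 = Tcyc l T n.+1 by rewrite /Tcyc -addSn modnDr.
have -> : x (n.+1 + l)%N - x n.+1 = (x (n + l).+1 - w) - (x n.+1 - w).
  by rewrite opprB addrA subrK addSn.
rewrite addn1 !x_succ_sub Tw -/w subrr linear0 scaler0 subr0.
rewrite add0r -addrA -scalerBl.
apply: (le_trans (ler_normD _ _)); apply: lerD.
  apply: (le_trans (contraction _ _)); first by rewrite (leq_trans Qn)// leq_addr.
  apply: ler_wpM2l; first by rewrite subr_ge0; case/andP: (g_alpha01 (n + l).+1).
  exact: Tcyc_nonexpansive.
by rewrite normrZ distrC ler_wpM2l// residual_le.
Qed.

(** The orbit follows the partial compositions and picks up one error e per factor, since the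
    earlier errors pass through nonexpansive maps. *)
Lemma Ttilde_dist (e : R) n : (Q0 <= n)%N ->
  (forall j, (n < j)%N -> alpha j * ((B + 1) * K) <= e) ->
  `|x (n + l)%N - Ttilde l T n (x n)| <= l%:R * e.
Proof.
move=> Qn ae; rewrite /Ttilde; set F := fun j => _.
suff : forall k, `|x (n + k)%N - iteri k F (x n)| <= k%:R * e by apply.
elim=> [|k IHk]; first by rewrite addn0 subrr normr0 mul0r.
rewrite addnS /= {1}/F addn1.
apply: (le_trans (ler_distD (Tcyc l T (n + k).+1 (x (n + k)%N)) _ _)).
rewrite mulrSr mulrDl mul1r addrC; apply: lerD.
  exact: le_trans (Tcyc_nonexpansive _ _ _) IHk.
apply: (le_trans (x_succ_dist _)); first by rewrite (leq_trans Qn)// leq_addr.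
by apply: ae; rewrite ltnS leq_addr.
Qed.

(** Following the composition costs l/r. The increment x_(n+l) - x_n costs 1/r: half from the
    variation of [alpha], half from the initial gap 2K damped by the factor 1/(4Kr). *)
Lemma x_asymptotically_regular (r : R) (M n1 L : nat) : 0 < r ->
  (Q0 <= M)%N -> (M <= n1)%N ->
  (forall n m, (M < n <= m)%N ->
     \sum_(n <= i < m) `|alpha i - alpha (i + l)%N| <= (2 * (B + 1) * K * r)^-1) ->
  (forall n, (M < n)%N -> alpha n <= (2 * (B + 1) * K * r)^-1) ->
  ln (4 * K * r) / g <= L%:R ->
  L%:R <= \sum_(M <= j < n1) alpha (j + l + 1)%N ->
  forall n, (n1 <= n)%N -> `|x n - Ttilde l T n (x n)| <= (l%:R + 1) / r.
Proof.
move=> r0 QM Mn1 tv al Lln Lsum n n1n.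
set c := (B + 1) * K; have B1 : 0 < B + 1 by rewrite ltr_wpDl.
have c0 : 0 < c by exact: mulr_gt0.
have cr : c * (2 * (B + 1) * K * r)^-1 = 2^-1 / r.
  by rewrite /c; field; rewrite !gt_eqF.
have Mn := leq_trans Mn1 n1n; have Qn := leq_trans QM Mn.
have hT : `|x (n + l)%N - Ttilde l T n (x n)| <= l%:R * r^-1.
  apply: Ttilde_dist => // j nj; rewrite -/c mulrC.
  apply: (@le_trans _ _ (c * (2 * (B + 1) * K * r)^-1)).
    by rewrite ler_pM2l// al// (leq_ltn_trans Mn).
  rewrite cr; have : 0 < r^-1 by rewrite invr_gt0.
  lra.
suff hx : `|x (n + l)%N - x n| <= r^-1.
  apply: (le_trans (ler_distD (x (n + l)%N) _ _)).
  by rewrite mulrDl addrC mul1r lerD// distrC.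
pose s n := `|x (n + l)%N - x n|.
pose d n := `|alpha n.+1 - alpha (n.+1 + l)%N| * c.
pose a n := alpha (n + l + 1)%N.
have := @recursion_bound R s a d g 0 M (lexx 0) (normr_ge0 _).
have d0 k : (M <= k)%N -> 0 <= d k.
  by move=> _; apply: mulr_ge0 => //; exact: ltW.
have ga k : (M <= k)%N -> 0 <= g * a k <= 1 by move=> _; exact: g_alpha01.
have sr k : (M <= k)%N -> s k.+1 <= (1 - g * a k) * s k + g * a k * 0 + d k.
  by move=> Mk; rewrite mulr0 addr0; exact: (shift_step (leq_trans QM Mk)).
move=> /(_ d0 ga sr n Mn); rewrite addr0 => h.
apply: (le_trans h).
have hd : \sum_(M <= j < n) d j <= 2^-1 / r.
  rewrite /d -mulr_suml mulrC -cr ler_pM2l//.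
  have -> : \sum_(M <= i < n) `|alpha i.+1 - alpha (i.+1 + l)%N|
      = \sum_(M.+1 <= i < n.+1) `|alpha i - alpha (i + l)%N|.
    by rewrite big_add1.
  by apply: tv; rewrite ltnSn.
have sM : s M <= 2 * K.
  apply: (le_trans (ler_distD p _ _)); rewrite [`|p - _|]distrC.
  have := x_ball QM; have := x_ball (leq_trans QM (leq_addr l M)).
  lra.
have he : expR (- (g * \sum_(M <= j < n) a j)) <= (4 * K * r)^-1.
  have K4 : 0 < 4 * K * r by rewrite !mulr_gt0.
  have -> : (4 * K * r)^-1 = expR (- ln (4 * K * r)).
    by rewrite expRN lnK ?posrE.
  rewrite ler_expR lerN2 -ler_pdivrMl// mulrC; apply: (le_trans Lln).
  apply: (le_trans Lsum); rewrite (@big_cat_nat _ _ _ n1 M n)//= lerDl.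
  by apply: sumr_ge0 => i _; have /andP[/ltW] := alpha01 (i + l + 1)%N.
have : expR (- (g * \sum_(M <= j < n) a j)) * s M <= (4 * K * r)^-1 * (2 * K).
  by apply: ler_pM => //; exact: normr_ge0.
have -> : (4 * K * r)^-1 * (2 * K) = 2^-1 / r by field; rewrite !gt_eqF.
lra.
Qed.

Variable ip : {dot H for idfun}.
Hypothesis ip_norm : forall v : H, `|v| = Num.sqrt (ip v v).

(** As q is only almost fixed, every step adds 4Ke + e^2, and these errors are summed without
    damping. The factor n - M is why the precision of q has to depend on [ftilde f]. *)
Lemma x_sub_sq_le (q : H) (e b : R) (M : nat) :
  (Q0 <= M)%N -> `|q - p| <= K -> 0 <= e -> 0 <= b ->
  (forall i, (i < l)%N -> `|q - T i q| <= e) ->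
  (forall n, (M <= n)%N -> 2 * ip (u - A q) (x n - q) <= g * b) ->
  forall n, (M <= n)%N ->
    `|x n - q| ^+ 2 <= expR (- (g * \sum_(M <= j < n) alpha j.+1))
        * (4 * K ^+ 2) + b + (n - M)%:R * (4 * K * e + e ^+ 2).
Proof.
move=> QM qp e0 b0 qT ipq n Mn.
have xq k : (M <= k)%N -> `|x k - q| <= 2 * K.
  move=> Mk; apply: (le_trans (ler_distD p _ _)); rewrite [`|p - _|]distrC.
  by have := x_ball (leq_trans QM Mk); lra.
have c0 : 0 <= 4 * K * e + e ^+ 2 by rewrite addr_ge0 ?sqr_ge0// !mulr_ge0// ltW.
have s_rec k : (M <= k)%N -> `|x k.+1 - q| ^+ 2 <=
    (1 - g * alpha k.+1) * `|x k - q| ^+ 2 + g * alpha k.+1 * b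
    + (4 * K * e + e ^+ 2).
  move=> Mk; have /andP[a0 a1] := alpha01 k.+1.
  have /andP[ga0 ga1] := g_alpha01 k.+1.
  (* [normrD_sq_le] pairs u - A q with the new point, so the variational bound is used at index
     k.+1. *)
  have := ipq k.+1 (leqW Mk); rewrite x_succ_sub.
  set v := Tcyc _ _ _ _ - q; set a := alpha k.+1 in a0 a1 ga0 ga1 *.
  have vle : `|v| <= `|x k - q| + e.
    apply: (le_trans (ler_distD (Tcyc l T k.+1 q) _ _)); apply: lerD.
      exact: Tcyc_nonexpansive.
    by rewrite distrC; apply: qT; rewrite ltn_mod.
  have h := normrD_sq_le ip_norm (v - a *: A v) (a *: (u - A q)).
  move: h; rewrite (ipZl ip).
  set I := ip _ _ => h I_le.
  have hP : `|v - a *: A v| ^+ 2 <= (1 - g * a) * (`|x k - q| + e) ^+ 2.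
    have h1 := contraction (leq_trans QM Mk) v; rewrite -/a in h1.
    apply: (@le_trans _ _ (((1 - g * a) * `|v|) ^+ 2)).
      by apply: lerXn2r => //; rewrite nnegrE// mulr_ge0// subr_ge0.
    rewrite exprMn; apply: ler_pM; rewrite ?sqr_ge0//.
      by rewrite -[leRHS]mulr1 expr2 ler_wpM2l ?subr_ge0// gerBl.
    by apply: lerXn2r => //; rewrite nnegrE// addr_ge0.
  have aI : 2 * (a * I) <= g * a * b.
    by rewrite mulrCA [g * a]mulrC -mulrA ler_pM2l.
  apply: (le_trans h); have := xq k Mk => xk.
  have h2 : (1 - g * a) * (`|x k - q| + e) ^+ 2
      <= (1 - g * a) * (`|x k - q| ^+ 2 + (4 * K * e + e ^+ 2)).
    apply: ler_wpM2l; first by rewrite subr_ge0.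
    have : `|x k - q| * e <= 2 * K * e by exact: ler_wpM2r.
    lra.
  have h3 : 0 <= g * a * (4 * K * e + e ^+ 2) by exact: mulr_ge0.
  lra.
have := @recursion_bound R (fun k => `|x k - q| ^+ 2) (fun k => alpha k.+1)
  (fun=> 4 * K * e + e ^+ 2) g b M b0 (sqr_ge0 _) (fun _ _ => c0)
  (fun k _ => g_alpha01 k.+1) s_rec n Mn.
rewrite /= sumr_const_nat -(mulr_natl (_ + _ ^+ 2)) => /le_trans; apply.
rewrite lerD2r lerD2r ler_wpM2l ?expR_ge0//.
have -> : 4 * K ^+ 2 = (2 * K) ^+ 2 by ring.
by apply: lerXn2r; rewrite ?nnegrE// ?xq// mulr_ge0// ltW.
Qed.

Hypothesis A_self_adjoint : self_adjoint ip A.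

(** Expand J along the segment and divide by t: d/t is the defect of minimality, and the other term
    bounds the quadratic remainder, as |y - q| <= 2K. *)
Lemma variational_le (q y : H) (t d : R) : 0 < t ->
  `|q - p| <= K -> `|y - p| <= K ->
  energy ip A u q <= energy ip A u (q + t *: (y - q)) + d ->
  ip (u - A q) (y - q) <= d / t + 2 * t * B * K ^+ 2.
Proof.
move=> t0 qp yp.
have yq : `|y - q| <= 2 * K.
  by apply: (le_trans (ler_distD p _ _)); rewrite [`|p - _|]distrC; lra.
rewrite (energy_segment A_self_adjoint).
have h1 : ip (A (y - q)) (y - q) <= B * (4 * K ^+ 2).
  apply: (le_trans (ip_A_le ip_norm A_le _)); rewrite ler_wpM2l//.
  have -> : 4 * K ^+ 2 = (2 * K) ^+ 2 by ring.
  by apply: lerXn2r; rewrite ?nnegrE// mulr_ge0// ltW.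
have -> : ip (A q - u) (y - q) = - ip (u - A q) (y - q).
  by rewrite -opprB (ipNl ip).
move: (ip (A (y - q)) _) h1 => Z h1; move: (ip _ _) => I.
rewrite -(ler_pM2l t0).
have -> : t * (d / t + 2 * t * B * K ^+ 2) = d + 2^-1 * t ^+ 2 * (B * (4 * K ^+ 2)).
  by field; rewrite gt_eqF.
have : 2^-1 * t ^+ 2 * Z <= 2^-1 * t ^+ 2 * (B * (4 * K ^+ 2)).
  by apply: ler_wpM2l => //; rewrite mulr_ge0// sqr_ge0.
lra.
Qed.

End XuIteration.

(** * Ceilings, and monotonicity of the rates *)

Lemma ceiln_ge (R : realType) (y : R) : 0 <= y -> y <= (ceiln y)%:R.
Proof.
move=> y0; rewrite /ceiln natr_absz ger0_norm ?ceil_ge//.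
by rewrite ceil_ge0 (lt_le_trans _ y0)// ltrN10.
Qed.

Lemma ceiln_mono (R : realType) (y z : R) : 0 <= y -> y <= z ->
  (ceiln y <= ceiln z)%N.
Proof.
move=> y0 yz.
have c0 (v : R) : 0 <= v -> 0 <= Num.ceil v.
  by move=> v0; rewrite ceil_ge0 (lt_le_trans _ v0)// ltrN10.
have z0 := le_trans y0 yz.
by rewrite /ceiln -lez_nat !gez0_abs ?c0// le_ceil.
Qed.

Lemma ceiln_gt0 (R : realType) (y : R) : 0 < y -> (0 < ceiln y)%N.
Proof.
move=> y0; rewrite -(ltr_nat R); exact: lt_le_trans (ceiln_ge (ltW y0)).
Qed.

Section Rates.
Variables (R : realType) (gamma : R) (l K bA bU bp : nat).
Variables (sigma1 sigma2 sigma4 tau : nat -> nat) (alpha : nat -> R).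
Hypotheses (gamma_gt0 : 0 < gamma) (gamma_le1 : gamma <= 1).
Hypothesis K_gt0 : (0 < K)%N.
Hypothesis bA_gt0 : (0 < bA)%N.
Hypothesis alpha01 : forall n, 0 < alpha n <= 1.
Hypotheses (sigma1_mono : {homo sigma1 : m n / (m <= n)%N})
  (sigma2_mono : {homo sigma2 : m n / (m <= n)%N})
  (sigma4_mono : {homo sigma4 : m n / (m <= n)%N})
  (tau_mono : {homo tau : m n / (m <= n)%N}).
Hypothesis C2q : forall k, k%:R <= \sum_(0 <= n < (sigma2 k).+1) alpha n.

Local Notation Q := (Q bA sigma1).
Local Notation sigma := (sigma gamma K bA sigma1 sigma2).
Local Notation N4 := (N4 K bA sigma4).
Local Notation Sigmahat := (Sigmahat gamma l K bA sigma2 sigma4).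
Local Notation Psi := (Psi K bA sigma1).
Local Notation Phitilde := (Phitilde gamma l K bA sigma1 sigma2 sigma4).
Local Notation phitilde := (phitilde gamma l K bA sigma1 sigma2 sigma4 tau).
Local Notation h := (h gamma l K bA sigma1 sigma2 sigma4 tau).

Lemma ln_natr_ge0 n : 0 <= ln (n%:R : R).
Proof.
case: n => [|n]; first by rewrite ln0.
by apply: ln_ge0; rewrite ler1n.
Qed.

Lemma sum_alpha_le m n : (m <= n)%N -> \sum_(m <= i < n) alpha i <= (n - m)%:R.
Proof.
move=> mn; rewrite -[leRHS]mulr1; apply: sum_le_const => // i _.
by have /andP[] := alpha01 i.
Qed.

Lemma sum_alpha_mono m n : (m <= n)%N ->
  \sum_(0 <= i < m) alpha i <= \sum_(0 <= i < n) alpha i.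
Proof.
move=> mn; rewrite (@big_cat_nat _ _ _ m 0 n)//= lerDl.
by apply: sumr_ge0 => i _; have /andP[/ltW] := alpha01 i.
Qed.

Lemma leq_sigma2 m : (m <= (sigma2 m).+1)%N.
Proof.
rewrite -(ler_nat R); apply: (le_trans (C2q m)).
by have := sum_alpha_le (leq0n (sigma2 m).+1); rewrite subn0.
Qed.

(** Lowering the index by [Q] removes [Q] terms of size at most 1, which the summand [Q + 1] inside
    [sigma2] pays for. The remaining 1 later absorbs the 1 in the sum bound of [x_almost_fixed]. *)
Lemma sigma_sum k n (c := ceiln (ln ((12 * K ^ 2 * (k + 1))%:R : R))) :
  (n + c)%:R / gamma + 1 <= \sum_(0 <= i < (sigma k n).+1) alpha i.
Proof.
rewrite /sigma /Defs.sigma -/c; set a := ceiln _.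
set N' := sigma2 _; have QN : (Q <= N')%N.
  by have := leq_sigma2 (a + Q + 1); rewrite -/N'; lia.
have ha : (n + c)%:R / gamma <= a%:R by rewrite ceiln_ge// divr_ge0// ltW.
have := C2q (a + Q + 1); rewrite -/N'.
rewrite (@big_cat_nat _ _ _ (N' - Q).+1 0 N'.+1)//=; last by rewrite ltnS leq_subr.
have := @sum_alpha_le (N' - Q).+1 N'.+1; rewrite ltnS leq_subr => /(_ isT).
rewrite subSS subKn// !natrD; lra.
Qed.

Lemma leq_sigma k m n : (m <= n)%N -> (sigma k m <= sigma k n)%N.
Proof.
move=> mn; rewrite /Defs.sigma leq_sub2r// sigma2_mono// !leq_add2r.
apply: ceiln_mono; first by rewrite divr_ge0// ltW.
by rewrite ler_pM2r ?invr_gt0// ler_nat leq_add2r.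
Qed.

Lemma leq_phitilde m n : (m <= n)%N -> (phitilde m <= phitilde n)%N.
Proof.
move=> /tau_mono; rewrite /Defs.phitilde; move: (tau m) (tau n) => {}m {}n mn.
have mn' : ((l + 1) * (m + 1) - 1 <= (l + 1) * (n + 1) - 1)%N.
  by rewrite leq_sub2r// leq_mul2l leq_add2r mn orbT.
rewrite /Defs.Phitilde; move: (_ - 1)%N (_ * (n + 1) - 1)%N mn' => i j ij.
have ij1 : (i + 1 <= j + 1)%N by rewrite leq_add2r.
have Sij : (Sigmahat i <= Sigmahat j)%N.
  apply: sigma2_mono; apply: leq_add.
    by rewrite !leq_add2r; apply: sigma4_mono; rewrite leq_sub2r// leq_mul2l ij1 orbT.
  apply: ceiln_mono; first by rewrite divr_ge0 ?ln_natr_ge0// ltW.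
  rewrite ler_pM2r ?invr_gt0//; rewrite ler_ln ?posrE ?ltr0n.
  - by rewrite ler_nat leq_mul2l ij1 orbT.
  - by rewrite !muln_gt0 K_gt0 addn1.
  - by rewrite !muln_gt0 K_gt0 addn1.
have Pij : (Psi i <= Psi j)%N.
  by rewrite leq_sub2r//; apply: sigma1_mono; rewrite leq_sub2r// leq_mul2l ij1 orbT.
by rewrite geq_max !leq_max Sij Pij orbT.
Qed.

Lemma h_ge k f m (F := ftilde f (sigma (k0 k) (phitilde (Km K m)))) :
  [/\ (24 * K * (k0 k + 1) * (F + 1) <= h k f m)%N,
      (Km K m <= h k f m)%N & (m <= h k f m)%N].
Proof.
have Kh : (Km K m <= h k f m)%N 
  by apply: leq_trans (leq_addr _ _); rewrite !leq_max leqnn !orbT.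
split => //.
  apply: leq_trans (leq_addr _ _); apply: leq_trans (leq_maxl _ _).
  exact: leq_maxl.
apply: leq_trans Kh; rewrite /Km -mulnn mulnA.
apply: leq_trans (leq_addr 1 m) _; apply: leq_pmull.
by rewrite !muln_gt0 K_gt0 addn1.
Qed.

Lemma leq_iter_h k f i j : (i <= j)%N -> (iter i (h k f) 0 <= iter j (h k f) 0)%N.
Proof.
move=> /subnK <-; elim: (j - i)%N => //= d IHd.
by apply: (leq_trans IHd); have [] := h_ge k f (iter (d + i) (h k f) 0).
Qed.

(** The level i selected by the descent is not known in advance, so the bound is taken at the last
    iterate, by monotonicity of all rates. *)
Lemma leq_Omega k f i : (i < E gamma K bA bU bp k)%N ->
  (sigma (k0 k) (phitilde (Km K (iter i (h k f) 0)))
   <= Omega gamma l K bA bU bp sigma1 sigma2 sigma4 tau k f)%N.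
Proof.
move=> iE; apply: (leq_trans _ (leq_addr _ _)).
apply: leq_sigma; apply: leq_phitilde.
by rewrite /Km leq_mul2l leq_exp2r// leq_add2r leq_iter_h ?orbT// ltnW.
Qed.

(** [Psi] evaluates [sigma1] at an argument of at least bA - 1. This gives [exists_block] its
    condition M <= n when M is the maximum of [N4] and [Q]. *)
Lemma Q_le_Phitilde n : (Q <= Phitilde n)%N.
Proof.
rewrite /Defs.Phitilde; apply: leq_trans (leq_maxr _ _).
by rewrite leq_sub2r//; apply: sigma1_mono; rewrite leq_sub2r//; nia.
Qed.

End Rates.

(** * Numerical bounds behind the constants *)

Section Arithmetic.
Variable R : realType.
Implicit Types B K c G D E t g e F M : R.

(** With this t the two errors of [variational_le] are 1/72 and 1/48 of 1/(c G^2); twice their sum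
    is 5/72 of it. The constant 6912 is 2^8 3^3, as in [E]. *)
Lemma slope_bound B K c G g (t := (96 * B * K ^+ 2 * c * G ^+ 2)^-1) :
  0 < B -> 0 < K -> 0 < c -> 0 < G -> c^-1 <= g ->
  2 * ((6912 * B * K ^+ 2 * c ^+ 2 * G ^+ 4)^-1 / t + 2 * t * B * K ^+ 2)
    <= g * (5 / 72 / G ^+ 2).
Proof.
move=> B0 K0 c0 G0 cg; rewrite /t.
have -> : 2 * ((6912 * B * K ^+ 2 * c ^+ 2 * G ^+ 4)^-1
      / (96 * B * K ^+ 2 * c * G ^+ 2)^-1
    + 2 * (96 * B * K ^+ 2 * c * G ^+ 2)^-1 * B * K ^+ 2)
    = c^-1 * (5 / 72 / G ^+ 2).
  by field; rewrite !gt_eqF.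
by rewrite ler_wpM2r// divr_ge0// sqr_ge0.
Qed.

(** For M = (m + 1)^2 this turns precision 1/([Km] + 1) at the endpoints into precision 1/(m + 1)
    along the segment. *)
Lemma segment_error_bound K M e : 0 <= e -> 1 <= K -> 1 <= M ->
  24 * K * M * e <= 1 -> e * (2 * K) + e ^+ 2 <= M^-1.
Proof.
move=> e0 K1 M1 KMe.
have M0 : 0 < M by exact: lt_le_trans M1.
rewrite -[leRHS]mul1r ler_pdivlMr//.
have Me0 : 0 <= M * e by rewrite mulr_ge0// ltW.
have h1 : 1 * (M * e) <= K * (M * e) by rewrite ler_wpM2r.
have h2 : 1 * e <= M * e by rewrite ler_wpM2r.
have e1 : e <= 1 by lra.
have h3 : e * (M * e) <= 1 * (M * e) by rewrite ler_wpM2r.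
lra.
Qed.

(** This is applied with G = (k + 1)^2, so that 96 K G is the factor 24 K (k0 + 1) of [eta]. *)
Lemma total_error_bound K G F e : 0 <= e -> 1 <= K -> 1 <= G -> 0 <= F ->
  96 * K * G * (F + 1) * e <= 1 -> F * (4 * K * e + e ^+ 2) <= 7 / 72 / G.
Proof.
move=> e0 K1 G1 F0 eF.
have G0 : 0 < G by exact: lt_le_trans G1.
have K0 : 0 < K by exact: lt_le_trans K1.
rewrite ler_pdivlMr//.
have KGe : 0 <= K * G * e by rewrite !mulr_ge0// ltW.
have FGe : 0 <= F * (K * G * e) by exact: mulr_ge0.
have h1 : 1 * (F * G * e) <= K * (F * G * e) by rewrite ler_wpM2r// !mulr_ge0// ltW.
have h2 : 1 * (G * e) <= K * (G * e) by rewrite ler_wpM2r// mulr_ge0// ltW.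
have h3 : 1 * e <= G * e by rewrite ler_wpM2r.
have e1 : e <= 1 by lra.
have h4 : e * (F * G * e) <= 1 * (F * G * e).
  by rewrite ler_wpM2r// !mulr_ge0// ltW.
lra.
Qed.

Lemma expRN_le (c G : R) : 0 < c -> ln c <= G -> expR (- G) <= c^-1.
Proof.
move=> c0 cG; rewrite expRN lef_pV2 ?posrE ?expR_gt0//.
by rewrite -[leLHS](@lnK R) ?posrE// ler_expR.
Qed.

End Arithmetic.

(** * Consequences of the quantitative conditions *)

Lemma convex_sub (R : realType) (H : lmodType R) (t : R) (q y p : H) :
  q + t *: (y - q) - p = (1 - t) *: (q - p) + t *: (y - p).
Proof.
rewrite scalerBl scale1r addrAC -[RHS]addrA; congr (_ + _).
by rewrite addrC -scalerBr opprB addrA subrK.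
Qed.

Lemma partial_sum_cauchy (R : realType) (b : nat -> R) (N n m : nat) (e : R) :
  (forall i j, (N <= i)%N -> (N <= j)%N ->
    `|\sum_(0 <= t < i.+1) b t - \sum_(0 <= t < j.+1) b t| <= e) ->
  (N < n <= m)%N -> \sum_(n <= t < m) b t <= e.
Proof.
move=> bN /andP[]; case: n => [//|n]; case: m => [//|m] Nn nm.
have := bN m n (leq_trans Nn nm) Nn.
rewrite [X in X - _](@big_cat_nat _ _ _ n.+1)//= addrAC subrr add0r.
exact: le_trans (ler_norm _).
Qed.

Lemma rate_vanish (R : realType) (alpha : nat -> R) (sigma1 : nat -> nat) :
  (forall k n, (sigma1 k <= n)%N -> alpha n <= 1 / (k + 1)%:R) ->
  forall d : R, 0 < d -> exists n0, forall n, (n0 <= n)%N -> alpha n <= d.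
Proof.
move=> a1 d d0; exists (sigma1 (ceiln d^-1)) => n /a1 /le_trans; apply.
rewrite div1r invf_ple ?posrE ?ltr0n ?addn1// -addn1 natrD.
have : d^-1 <= (ceiln d^-1)%:R by rewrite ceiln_ge// invr_ge0 ltW.
lra.
Qed.

(** * Almost fixed iterates, the approximate minimizer, and metastability *)

Section Metastability.
Variables (R : realType) (H : normedModType R).
Variables (ip : {dot H for idfun}) (A : {linear H -> H}) (gamma : R).
Variables (l : nat) (T : nat -> H -> H) (u p : H) (alpha : nat -> R).
Variables (x : nat -> H) (bA bU bp K : nat) (sigma1 sigma2 sigma4 tau : nat -> nat).
Hypothesis ip_norm : forall v : H, `|v| = Num.sqrt (ip v v).
Hypothesis A_self_adjoint : self_adjoint ip A.
Hypotheses (gamma_gt0 : 0 < gamma) (gamma_le1 : gamma <= 1).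
Hypothesis A_coercive : forall v : H, gamma * `|v| ^+ 2 <= ip (A v) v.
Hypothesis l_gt0 : (0 < l)%N.
Hypothesis T_nonexpansive : forall i, (i < l)%N -> nonexpansive (T i).
Hypothesis T_p : forall i, (i < l)%N -> T i p = p.
Hypothesis alpha01 : forall n, 0 < alpha n <= 1.
Hypothesis x_rec : forall n, x n.+1 =
  (Tcyc l T n.+1 (x n) - alpha n.+1 *: A (Tcyc l T n.+1 (x n)))
  + alpha n.+1 *: u.
Hypotheses (bA_gt0 : (0 < bA)%N) (K_gt0 : (0 < K)%N).
Hypothesis A_le : forall v, `|A v| <= bA%:R * `|v|.
Hypotheses (u_le : `|u| <= bU%:R) (p_le : `|p| <= bp%:R).
Hypotheses (sigma1_mono : {homo sigma1 : m n / (m <= n)%N})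
  (sigma2_mono : {homo sigma2 : m n / (m <= n)%N})
  (sigma4_mono : {homo sigma4 : m n / (m <= n)%N})
  (tau_mono : {homo tau : m n / (m <= n)%N}).
Hypothesis C1q : forall k n, (sigma1 k <= n)%N -> alpha n <= 1 / (k + 1)%:R.
Hypothesis C2q : forall k, k%:R <= \sum_(0 <= n < (sigma2 k).+1) alpha n.
Hypothesis C4q : forall k n m, (sigma4 k <= n)%N -> (sigma4 k <= m)%N ->
  `| \sum_(0 <= i < n.+1) `|alpha i - alpha (i + l)%N|
     - \sum_(0 <= i < m.+1) `|alpha i - alpha (i + l)%N| | <= 1 / (k + 1)%:R.
Hypotheses (xQ_le : `|x (Q bA sigma1) - p| <= K%:R)
  (uAp_le : `|u - A p| <= gamma * K%:R).
Hypothesis tauP : forall (k m : nat) (y : H), closed_ball_ Num.norm p K%:R y ->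
  `|y - Ttilde l T m y| <= 1 / (tau k + 1)%:R ->
  forall i, (i < l)%N -> `|y - T i y| < 1 / (k + 1)%:R.

Local Notation Q := (Q bA sigma1).
Local Notation N4 := (N4 K bA sigma4).
Local Notation sigma := (sigma gamma K bA sigma1 sigma2).
Local Notation phitilde := (phitilde gamma l K bA sigma1 sigma2 sigma4 tau).
Local Notation h := (h gamma l K bA sigma1 sigma2 sigma4 tau).

Lemma bA_ge1 : 1 <= bA%:R :> R. Proof. by rewrite ler1n. Qed.

Lemma K_ge1 : 1 <= K%:R :> R. Proof. by rewrite ler1n. Qed.

(** For n >= [Q] the index n.+1 is at least sigma1 (bA - 1), so alpha n.+1 <= 1/bA and 1 - alpha A
    is positive, as [norm_id_sub_le] requires. *)
Lemma contraction_from_Q n : (Q <= n)%N ->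
  forall v, `|v - alpha n.+1 *: A v| <= (1 - gamma * alpha n.+1) * `|v|.
Proof.
move=> Qn v; have /andP[a0 a1] := alpha01 n.+1.
rewrite (mulrC gamma).
apply: (norm_id_sub_le ip_norm A_self_adjoint A_coercive A_le (ltW a0)).
  by rewrite mulr_ile1// ltW.
have : alpha n.+1 <= 1 / (bA - 1 + 1)%:R.
  by apply: C1q; move: Qn; rewrite /Defs.Q leq_subLR add1n.
by rewrite subnK// ler_pdivlMr// ltr0n.
Qed.

Lemma x_in_ball n : (Q <= n)%N -> `|x n - p| <= K%:R.
Proof.
exact: (x_ball gamma_gt0 gamma_le1 l_gt0 alpha01 T_nonexpansive T_p x_rec
  contraction_from_Q xQ_le uAp_le).
Qed.

(** The index n1 itself is not compared with [phitilde k]; only the sum of [alpha] up to n1 is, and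
    [sigma_sum] is stated in the same currency. *)
Lemma x_almost_fixed k : exists n1, [/\ (Q <= n1)%N,
  \sum_(0 <= i < n1.+1) alpha i <= (phitilde k + 1)%:R &
  forall n, (n1 <= n)%N -> forall i, (i < l)%N ->
    `|x n - T i (x n)| <= 1 / (k + 1)%:R].
Proof.
(* With r = k' + 1, the bound (l + 1)/r of asymptotic regularity becomes 1/(tau k + 1), the premise
   of [tauP]. *)
set k' := ((l + 1) * (tau k + 1) - 1)%N.
have k'1 : (k' + 1 = (l + 1) * (tau k + 1))%N.
  by rewrite /k' subnK// muln_gt0 !addn1.
set r : R := (k' + 1)%:R; have r1 : 1 <= r by rewrite ler1n addn1.
have B1 := bA_ge1; have K1 := K_ge1.
set e := (2 * (bA%:R + 1) * K%:R * r)^-1.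
have eE : e = 1 / (2 * (bA + 1) * K * (k' + 1) - 1 + 1)%:R.
  rewrite div1r subnK; last by rewrite !muln_gt0 K_gt0 !addn1.
  by rewrite /e /r !natrM !natrD.
have tv n m : (N4 k' < n <= m)%N ->
    \sum_(n <= i < m) `|alpha i - alpha (i + l)%N| <= e.
  by apply: partial_sum_cauchy => i j Ni Nj; rewrite eE; exact: C4q.
have ae := le_tail_variation l_gt0 (rate_vanish C1q) tv.
have e12 : 0 <= e <= 2^-1.
  have Kr : 1 <= K%:R * r by rewrite -[leLHS]mulr1 ler_pM.
  have d2 : 2 <= 2 * (bA%:R + 1) * K%:R * r.
    rewrite -mulrA; apply: (@le_trans _ _ (2 * (bA%:R + 1) * 1)); first lra.
    by rewrite ler_pM2l//; lra.
  by rewrite /e invr_ge0 lef_pV2 ?posrE; [apply/andP; split|..]; lra.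
set L := ceiln (ln ((4 * K * (k' + 1))%:R : R) / gamma).
have K4 : (1 < 4 * K * (k' + 1))%N.
  by rewrite -mulnA (leq_trans (isT : 1 < 4)%N)// leq_pmulr// muln_gt0 K_gt0 addn1.
have L0 : (0 < L)%N.
  by apply: ceiln_gt0; rewrite divr_gt0// ln_gt0// ltr1n.
have Lln : ln (4 * K%:R * r) / gamma <= L%:R.
  rewrite /r -!natrM ceiln_ge// divr_ge0 ?ln_natr_ge0// ltW//.
set n := phitilde k.
have nQ : (Q <= n)%N by exact: Q_le_Phitilde.
have Sn : (Sigmahat gamma l K bA sigma2 sigma4 k' <= n)%N by exact: leq_maxl.
have n_sum : (N4 k' + l + 1 + L)%:R <= \sum_(0 <= i < n.+1) alpha i.
  by apply: (le_trans (C2q _)); apply: sum_alpha_mono.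
have nN : (N4 k' <= n)%N.
  rewrite -ltnS; apply: leq_trans (_ : _ <= N4 k' + l + 1 + L)%N _.
    by rewrite -addn1 -!addnA leq_add2l addnCA leq_addr.
  rewrite -(ler_nat R); apply: (le_trans n_sum).
  by have := sum_alpha_le alpha01 (leq0n n.+1); rewrite subn0.
(* The recursion can start only when the variation is small (after [N4]) and the maps contract
   (after [Q]), hence the maximum. *)
have [] := @exists_block R alpha e l (N4 k') (maxn (N4 k') Q) L n l_gt0 L0 e12
  _ ae (leq_maxl _ _) _ n_sum _.
- by move=> i; have /andP[/ltW -> ->] := alpha01 i.
- by rewrite geq_max nN.
- by move=> j; exists (sigma2 j).+1.
move=> n1 [Mn1 Lsum n1sum]; exists n1.
have Qn1 : (Q <= n1)%N by apply: leq_trans Mn1; exact: leq_maxr.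
split => // m n1m i il.
have reg := x_asymptotically_regular gamma_gt0 gamma_le1 (ler0n _ bA)
  (lt_le_trans ltr01 K1) A_le l_gt0 alpha01 T_nonexpansive T_p x_rec
  contraction_from_Q xQ_le uAp_le (lt_le_trans ltr01 r1)
  (leq_maxr (N4 k') Q) Mn1 _ _ Lln Lsum n1m.
apply/ltW/(tauP (m := m)) => //.
  by rewrite /closed_ball_/= distrC x_in_ball// (leq_trans Qn1).
apply: (le_trans (reg _ _)).
- move=> i0 m0 /andP[Ni im]; apply: tv.
  by rewrite im andbT; apply: leq_ltn_trans Ni; exact: leq_maxl.
- by move=> j Nj; apply: ae; apply: leq_ltn_trans Nj; exact: leq_maxl.
rewrite /r k'1 natrM natrD invfM mulrA divff ?mul1r//.
Qed.

Lemma ceiln_inv_ge : (ceiln (1 / gamma : R))%:R^-1 <= gamma.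
Proof.
have h1 : 1 / gamma <= (ceiln (1 / gamma : R))%:R.
  by apply: ceiln_ge; rewrite divr_ge0// ltW.
move: (ceiln _) h1 => c h1.
have c0 : 0 < c%:R :> R by apply: lt_le_trans h1; rewrite divr_gt0.
by rewrite invf_ple ?posrE// -div1r.
Qed.

Lemma ceiln_inv_gt0 : (0 < ceiln (1 / gamma : R))%N.
Proof. by apply: ceiln_gt0; rewrite divr_gt0. Qed.

Lemma exists_energy_almost_min k f (c := ceiln (1 / gamma : R))
    (m := fun i => iter i (h k f) 0%N) :
  exists2 i, (i < E gamma K bA bU bp k)%N & exists q, [/\ `|q - p| <= K%:R,
    forall j, (j < l)%N -> `|q - T j q| <= 1 / (m i.+1 + 1)%:R &
    forall y, `|y - p| <= K%:R ->
      (forall j, (j < l)%N -> `|y - T j y| <= 1 / (m i + 1)%:R) ->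
      energy ip A u q <= energy ip A u y +
        (6912 * bA%:R * K%:R ^+ 2 * c%:R ^+ 2 * (k + 1)%:R ^+ 4)^-1].
Proof.
pose Kt : R := (Ktilde K bp)%:R.
have Kt_ge : K%:R + bp%:R <= Kt by rewrite -natrD.
have Kt_pos : 0 < Kt by apply: lt_le_trans Kt_ge; rewrite ltr_wpDr ?ltr0n.
have norm_ball y : `|y - p| <= K%:R -> `|y| <= Kt.
  move=> yp; rewrite -(subrK p y); apply: (le_trans (ler_normD _ _)).
  by apply: le_trans Kt_ge; exact: lerD.
pose d := (ceiln (2^-1 * (bA * Ktilde K bp ^ 2)%:R : R)
  + 2 * bU * Ktilde K bp)%N.
have d_ge : 2^-1 * (bA%:R * Kt ^+ 2) + 2 * bU%:R * Kt <= d%:R.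
  rewrite /d natrD; apply: lerD; last by rewrite !natrM.
  have -> : bA%:R * Kt ^+ 2 = (bA * Ktilde K bp ^ 2)%:R by rewrite natrM natrX.
  by rewrite ceiln_ge// mulr_ge0.
have d_gt0 : (0 < d)%N.
  rewrite -(ltr_nat R); apply: lt_le_trans d_ge.
  rewrite ltr_wpDr ?mulr_ge0// ?(ltW Kt_pos)//.
  by rewrite mulr_gt0 ?invr_gt0// mulr_gt0 ?exprn_gt0// ltr0n.
have E_gt0 : (0 < E gamma K bA bU bp k)%N.
  by rewrite /E -/d !(expn_gt0, muln_gt0) bA_gt0 K_gt0 d_gt0 ceiln_inv_gt0 addn1.
set b := (_ ^-1).
(* [E] is the bound d on the range of J divided by the tolerance b, so that E failures exhaust the
   range. *)
have Eb : (E gamma K bA bU bp k)%:R * b = d%:R.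
  have natr_E (a1 a2 a3 a4 a5 : nat) :
      (2 ^ 8 * 3 ^ 3 * a1 * a2 ^ 2 * a3 * a4 ^ 2 * a5 ^ 4)%:R
      = 6912 * a1%:R * a2%:R ^+ 2 * a3%:R * a4%:R ^+ 2 * a5%:R ^+ 4 :> R.
    rewrite !(natrX, natrM); ring.
  rewrite /E -/d natr_E /b -/c; field.
  by rewrite !gt_eqF// ltr0n ?addn1// ceiln_inv_gt0.
pose C i y := `|y - p| <= K%:R /\
  forall j, (j < l)%N -> `|y - T j y| <= 1 / (m i + 1)%:R.
have Cp i : C i p.
  split; first by rewrite subrr normr0.
  by move=> j jl; rewrite T_p// subrr normr0 divr_ge0.
have energy_low y : C 0%N y ->
    energy ip A u p - (E gamma K bA bU bp k)%:R * b <= energy ip A u y.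
  move=> [/norm_ball yK _]; rewrite Eb lerBlDr -lerBlDl.
  have pK : `|p| <= Kt by apply: norm_ball; rewrite subrr normr0.
  apply: (le_trans (energy_diff_le ip_norm A_coercive A_le u (ler0n _ _)
    (ltW gamma_gt0) pK yK)).
  by apply: le_trans d_ge; rewrite lerD2l ler_pM2r// ler_pM2l.
have [i [iE [q [qp qT] q_min]]] := exists_almost_min E_gt0 Cp energy_low.
by exists i => //; exists q; split => // y yp yT; exact: q_min.
Qed.

(** The endpoints q and y have precision 1/([Km K m] + 1), so the segment point w = q + t (y - q)
    has precision 1/(m + 1), the level at which q almost minimizes J. It also stays in the ball by
    convexity. *)
Lemma variational_almost_min k m (e : R) q y (c := ceiln (1 / gamma : R)) :
  `|q - p| <= K%:R -> `|y - p| <= K%:R -> 0 <= e <= 1 / (Km K m + 1)%:R ->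
  (forall j, (j < l)%N -> `|q - T j q| <= e) ->
  (forall j, (j < l)%N -> `|y - T j y| <= 1 / (Km K m + 1)%:R) ->
  (forall z, `|z - p| <= K%:R ->
    (forall j, (j < l)%N -> `|z - T j z| <= 1 / (m + 1)%:R) ->
    energy ip A u q <= energy ip A u z +
      (6912 * bA%:R * K%:R ^+ 2 * c%:R ^+ 2 * (k + 1)%:R ^+ 4)^-1) ->
  2 * ip (u - A q) (y - q) <= gamma * (5 / 72 / (k + 1)%:R ^+ 2).
Proof.
move=> qp yp /andP[e0 ee'] qT yT q_min.
have K0 : 0 < K%:R :> R by rewrite ltr0n.
set e' : R := 1 / (Km K m + 1)%:R in ee' yT.
have e'0 : 0 <= e' := le_trans e0 ee'.
have k0 : 0 < (k + 1)%:R :> R by rewrite ltr0n addn1.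
have c0 : 0 < c%:R :> R by rewrite ltr0n ceiln_inv_gt0.
have B0 : 0 < bA%:R :> R by rewrite ltr0n.
set t : R := (96 * bA%:R * K%:R ^+ 2 * c%:R * (k + 1)%:R ^+ 2)^-1.
have den1 : 1 <= 96 * bA%:R * K%:R ^+ 2 * c%:R * (k + 1)%:R ^+ 2 :> R.
  rewrite -!natrX -!natrM ler1n !(expn_gt0, muln_gt0) bA_gt0 K_gt0 addn1 /=.
  by rewrite /c ceiln_inv_gt0.
have t0 : 0 < t by rewrite invr_gt0 (lt_le_trans _ den1).
have t1 : t <= 1 by rewrite /t invf_le1// (lt_le_trans _ den1).
have t01 : 0 <= t <= 1 by rewrite (ltW t0).
have yq : `|y - q| <= 2 * K%:R.
  apply: (le_trans (ler_distD p _ _)); rewrite [`|p - _|]distrC mulr_natl mulr2n.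
  exact: lerD.
have wp : `|q + t *: (y - q) - p| <= K%:R.
  rewrite convex_sub; apply: (le_trans (ler_normD _ _)); rewrite !normrZ.
  rewrite (ger0_norm (ltW t0)) ger0_norm ?subr_ge0//.
  rewrite -[leRHS]mul1r -[X in X * K%:R](subrK t) [leRHS]mulrDl.
  by apply: lerD; apply: ler_wpM2l => //; rewrite ?subr_ge0// ltW.
have wT j : (j < l)%N ->
    `|q + t *: (y - q) - T j (q + t *: (y - q))| <= 1 / (m + 1)%:R.
  move=> jl.
  have seg := segment_almost_fixed ip_norm (T_nonexpansive jl) t01 e'0 yq
    (le_trans (qT j jl) ee') (yT j jl).
  have m1 : 1 <= (m + 1)%:R :> R by rewrite ler1n addn1.
  rewrite -(@ler_pXn2r _ 2)// ?nnegrE ?divr_ge0//.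
  apply: (le_trans seg); rewrite [leRHS](_ : _ = ((m + 1)%:R ^+ 2)^-1); last first.
    by rewrite div1r exprVn.
  apply: segment_error_bound => //; [exact: K_ge1 | exact: exprn_ege1 |].
  rewrite /e' div1r ler_pdivrMr; last by rewrite ltr0n addn1.
  rewrite mul1r -natrX -!natrM ler_nat.
  exact: leq_addr.
have := variational_le (ler0n _ bA) K0 A_le ip_norm A_self_adjoint t0
  qp yp (q_min _ wp wT).
rewrite -(ler_pM2l (ltr0n R 2)) => /le_trans; apply.
exact: slope_bound ceiln_inv_ge.
Qed.

(* N := sigma (k0 k) (phitilde (Km K m)), without the shift by Q of Omega:    *)
(* h only controls ftilde at this N.                                          *)
Lemma metastable k f : exists2 N : nat,
  (N <= Omega gamma l K bA bU bp sigma1 sigma2 sigma4 tau k f)%N &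
  forall i j : nat, (N <= i <= ftilde f N)%N -> (N <= j <= ftilde f N)%N ->
    `|x i - x j| <= 1 / (k + 1)%:R.
Proof.
have K_pos : 0 < K%:R :> R by rewrite ltr0n.
set G : R := (k + 1)%:R; have G1 : 1 <= G by rewrite ler1n addn1.
have G_pos : 0 < G := lt_le_trans ltr01 G1.
have G2 : 0 < G ^+ 2 by exact: exprn_gt0.
have [i iE [q [qp qT q_min]]] := exists_energy_almost_min k f.
pose m := iter i (h k f) 0%N; rewrite -/m in q_min.
set n := phitilde (Km K m).
pose N := sigma (k0 k) n; pose F := ftilde f N.
exists N; first exact: leq_Omega.
have [h1 h2 _] := h_ge gamma l bA sigma1 sigma2 sigma4 tau K_gt0 k f m.
rewrite -/n -/N -/F in h1.
have [n1 [Qn1 n1sum n1fix]] := x_almost_fixed (Km K m).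
rewrite -/n natrD in n1sum.
set e : R := 1 / (iter i.+1 (h k f) 0%N + 1)%:R in qT.
have e_ge0 : 0 <= e by rewrite divr_ge0.
have ee' : 0 <= e <= 1 / (Km K m + 1)%:R.
  rewrite e_ge0 /e !div1r lef_pV2 ?posrE ?ltr0n ?addn1// ler_nat ltnS.
  exact: h2.
have b0 : 0 <= 5 / 72 / G ^+ 2 by rewrite divr_ge0// sqr_ge0.
have dist := x_sub_sq_le gamma_gt0 gamma_le1 K_pos l_gt0 alpha01
  T_nonexpansive T_p x_rec contraction_from_Q xQ_le uAp_le ip_norm Qn1 qp e_ge0
  b0 qT (fun s n1s => variational_almost_min qp (x_in_ball (leq_trans Qn1 n1s))
    ee' qT (n1fix s n1s) q_min).
set cc := ceiln (ln ((12 * K ^ 2 * (k0 k + 1))%:R : R)).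
have Nsum : (n + cc)%:R / gamma + 1 <= \sum_(0 <= t < N.+1) alpha t.
  exact: sigma_sum.
have k01 : (k0 k + 1 = 4 * (k + 1) ^ 2)%N.
  by rewrite /k0 subnK// muln_gt0 expn_gt0 addn1.
have ng : n%:R + cc%:R / gamma <= (n + cc)%:R / gamma.
  rewrite natrD mulrDl lerD2r -[leLHS]mulr1 ler_wpM2l//.
  by rewrite -div1r ler_pdivlMr ?mul1r.
have ccg : 0 < cc%:R / gamma.
  rewrite divr_gt0// ltr0n; apply: ceiln_gt0; rewrite ln_gt0// ltr1n k01.
  by rewrite -!mulnA (leq_trans (isT : 1 < 12)%N)// leq_pmulr// !(expn_gt0,
    muln_gt0) K_gt0 addn1.
(* If N < n1, the sum up to N would be at most n + 1, whereas [Nsum] makes it at least n + 1 +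
   cc/gamma. *)
have n1N : (n1 <= N)%N.
  rewrite leqNgt; apply/negP => Nn1.
  have := @sum_alpha_mono R alpha alpha01 N.+1 n1.+1 (ltnW Nn1).
  lra.
have close s : (N <= s <= F)%N -> `|x s - q| <= 2^-1 / G.
  move=> /andP[Ns sF]; have n1s := leq_trans n1N Ns.
  have hs := dist s n1s.
  have exp_le : expR (- (gamma * \sum_(n1 <= j < s) alpha j.+1))
      <= (12 * K%:R ^+ 2 * (4 * G ^+ 2))^-1.
    apply: expRN_le; first by rewrite !mulr_gt0// exprn_gt0.
    have -> : 12 * K%:R ^+ 2 * (4 * G ^+ 2) = (12 * K ^ 2 * (k0 k + 1))%:R :> R.
      by rewrite k01 /G !(natrX, natrM).
    apply: (@le_trans _ _ cc%:R); first by rewrite ceiln_ge// ln_natr_ge0.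
    rewrite mulrC -ler_pdivrMr//.
    have -> : \sum_(n1 <= j < s) alpha j.+1 = \sum_(n1.+1 <= j < s.+1) alpha j.
      by rewrite big_add1.
    (* Removing the sum up to n1, at most n + 1, from the bound [Nsum] leaves at least cc/gamma for
       the damping. *)
    have := @sum_alpha_mono R alpha alpha01 N.+1 s.+1 Ns.
    rewrite (@big_cat_nat _ _ _ n1.+1 0 s.+1)//=.
    lra.
  have eF : 96 * K%:R * G ^+ 2 * (F%:R + 1) * e <= 1.
    rewrite /e div1r ler_pdivrMr ?ltr0n ?addn1// mul1r.
    have natr_h (a g b : nat) : (24 * a * (4 * g ^ 2) * (b + 1))%:R
        = 96 * a%:R * g%:R ^+ 2 * (b%:R + 1) :> R.
      rewrite !(natrX, natrM) natrD; ring.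
    by rewrite -natr_h ler_nat -k01; apply: leqW.
  have sn1 : (s - n1)%:R <= F%:R :> R.
    by rewrite ler_nat (leq_trans (leq_subr _ _)).
  rewrite -(@ler_pXn2r _ 2)// ?nnegrE ?divr_ge0 ?invr_ge0 ?(ltW G_pos)//.
  apply: (le_trans hs).
  (* The shares go to the damped initial error, the variational error and the accumulated error, in
     this order. *)
  have -> : (2^-1 / G) ^+ 2 = 12^-1 / G ^+ 2 + 5 / 72 / G ^+ 2 + 7 / 72 / G ^+ 2.
    by field; rewrite gt_eqF.
  apply: lerD; first apply: lerD => //.
    have -> : 12^-1 / G ^+ 2
        = (12 * K%:R ^+ 2 * (4 * G ^+ 2))^-1 * (4 * K%:R ^+ 2).
      by field; rewrite !gt_eqF.
    by rewrite ler_wpM2r// mulr_ge0// sqr_ge0.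
  apply: (@le_trans _ _ (F%:R * (4 * K%:R * e + e ^+ 2))).
    by rewrite ler_wpM2r// addr_ge0 ?sqr_ge0// !mulr_ge0.
  apply: total_error_bound => //; [exact: K_ge1 | exact: exprn_ege1].
move=> s t sN tN.
apply: (le_trans (ler_distD q _ _)); rewrite [`|q - _|]distrC.
apply: (le_trans (lerD (close s sN) (close t tN))).
by rewrite -mulrDl [_ + _](_ : _ = 1)//; field.
Qed.

End Metastability.

Theorem theorem4 (R : realType) (H : completeNormedModType R)
    (ip : {dot H for idfun}) (ip_norm : forall x : H, `|x| = Num.sqrt (ip x x))
    (A : {linear H -> H}) (A_bounded : bounded_fun_norm A)
    (A_self_adjoint : self_adjoint ip A)
    (gamma : R) (gamma_gt0 : 0 < gamma) (gamma_le1 : gamma <= 1)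
    (A_coercive : forall x : H, gamma * `|x| ^+ 2 <= ip (A x) x)
    (l : nat) (l_ge1 : (1 <= l)%N) (T : nat -> H -> H)
    (T_nonexpansive : forall i, (i < l)%N -> nonexpansive (T i))
    (u : H) (alpha : nat -> R) (alpha01 : forall n, 0 < alpha n <= 1)
    (x : nat -> H)
    (x_rec : forall n, x n.+1 =
       (Tcyc l T n.+1 (x n) - alpha n.+1 *: A (Tcyc l T n.+1 (x n)))
       + alpha n.+1 *: u)
    (p : H) (pF : (\bigcap_(i in `I_l) Fix (T i)) p)
    (bA bU bp : nat) (bA_gt0 : (0 < bA)%N) (bU_gt0 : (0 < bU)%N)
    (bp_gt0 : (0 < bp)%N)
    (bA_ge : opnorm A <= bA%:R) (bU_ge : `|u| <= bU%:R) (bp_ge : `|p| <= bp%:R)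
    (sigma1 sigma2 sigma4 : nat -> nat)
    (sigma1_mono : {homo sigma1 : m n / (m <= n)%N})
    (sigma2_mono : {homo sigma2 : m n / (m <= n)%N})
    (sigma4_mono : {homo sigma4 : m n / (m <= n)%N})
    (C1q : forall k n, (sigma1 k <= n)%N -> alpha n <= 1 / (k + 1)%:R)
    (C2q : forall k, k%:R <= \sum_(0 <= n < (sigma2 k).+1) alpha n)
    (C4q : forall k n m, (sigma4 k <= n)%N -> (sigma4 k <= m)%N ->
       `| \sum_(0 <= i < n.+1) `|alpha i - alpha (i + l)%N|
          - \sum_(0 <= i < m.+1) `|alpha i - alpha (i + l)%N| |
       <= 1 / (k + 1)%:R)
    (K : nat) (K_gt0 : (0 < K)%N)
    (K_ge : Num.max `|x (Q bA sigma1) - p| (`|u - A p| / gamma) <= K%:R)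
    (tau : nat -> nat) (tau_mono : {homo tau : m n / (m <= n)%N})
    (tauP : forall (k m : nat) (y : H), closed_ball_ Num.norm p K%:R y ->
       `|y - Ttilde l T m y| <= 1 / (tau k + 1)%:R ->
       forall i, (i < l)%N -> `|y - T i y| < 1 / (k + 1)%:R) :
  forall (k : nat) (f : nat -> nat),
    exists2 N : nat,
      (N <= Omega gamma l K bA bU bp sigma1 sigma2 sigma4 tau k f)%N &
      forall i j : nat, (N <= i <= ftilde f N)%N -> (N <= j <= ftilde f N)%N ->
        `|x i - x j| <= 1 / (k + 1)%:R.
Proof.
have A_le v : `|A v| <= bA%:R * `|v|.
  by apply: (le_trans (opnorm_ge v A_bounded)); rewrite ler_wpM2r.
have T_p i : (i < l)%N -> T i p = p by exact: pF.
move: K_ge; rewrite ge_max ler_pdivrMr// mulrC => /andP[xQ uAp].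
exact: (metastable ip_norm A_self_adjoint gamma_gt0 gamma_le1 A_coercive l_ge1
  T_nonexpansive T_p alpha01 x_rec bA_gt0 K_gt0 A_le bU_ge bp_ge sigma1_mono
  sigma2_mono sigma4_mono tau_mono C1q C2q C4q xQ uAp tauP).
Qed.
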